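(* Let $R=\langle W,I,G,O,M\rangle$ be an online goal recognition problem in continuous spaces and let $\textit{planner}$ be a planner. If the heuristic $\mathrm{RECOMPUTE}$ is the constant function $\top$ (always true) and the heuristic $\mathrm{PRUNE}$ is the constant function $\bot$ (always false), then the algorithm Online Goal Recognition, run on $(R,\textit{planner})$, makes exactly the same number of planner calls as the baseline online recognition algorithm run on $(R,\textit{planner})$.
   Context: **Problem.** An online goal recognition problem in continuous spaces is a quintuple $R=\langle W,I,G,O,M\rangle$, where: $W\subseteq\mathbb{R}^n$ is the world; $I\in W$ is the initial pose of the observed agent; $G$ is a finite set of goals, each $g\in G$ being a point of $W$; $O$ is a finite set of observations, revealed one at a time in sequence, each $o\in O$ being a subset of $W$ (a point or a trajectory); $M$ is a (potentially infinite) set of plan trajectories, each beginning in $I$ and ending at some goal $g\in G$, such that for each $g\in G$ there is at least one plan in $M$ ending at $g$. **Planner.** A planner is a black-box procedure: $\textit{planner}(x,g)$ returns a trajectory from $x$ to $g$ (when $x$ is an observation, the trajectory starts at the last point of $x$). Each invocation of $\textit{planner}$ counts as one planner call. No other operation below calls the planner. **Notation.** $\oplus$ denotes concatenation of trajectories. For a trajectory $m_g^+$ and an observation $o$, $\textit{prefix}(o,m_g^+)$ is the part of $m_g^+$ from its beginning to the point of $m_g^+$ geometrically closest to $o$, and $\ominus$ denotes removing that initial part. For each goal, $\textit{score}(g)=\mathrm{cost}(i_g)/\mathrm{cost}(m_g)$ and $\eta=1/\sum_{g\in G}\textit{score}(g)$. **Algorithm Online Goal Recognition $(R,\textit{planner})$**,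 parametrized by two Boolean-valued heuristic functions $\mathrm{RECOMPUTE}(m_\upsilon,o)$ and $\mathrm{PRUNE}(m_g^+,o,g)$ (neither of which calls the planner): 1. For all $g\in G$: set $m_g,m_g^-\leftarrow\emptyset$. Set $\upsilon\leftarrow\emptyset$ (the top-ranked goal). 2. For all $g\in G$: $i_g\leftarrow\textit{planner}(I,g)$; $m_g^+\leftarrow i_g$. 3. While a new observation $o\in O$ is available: (a) If $\mathrm{RECOMPUTE}(m_\upsilon,o)$ is true: for all $g\in G$, if $\mathrm{PRUNE}(m_g^+,o,g)$ is true then $G\leftarrow G\setminus\{g\}$, else $m_g^+\leftarrow\textit{planner}(o,g)$. (b) Otherwise: for all $g\in G$, $m_g^+\leftarrow m_g^+\ominus\textit{prefix}(o,m_g^+)$. (c) For all $g\in G$: $m_g^-\leftarrow m_g^-\oplus o$ and $m_g\leftarrow m_g^-\oplus m_g^+$. (d) For all $g\in G$: $Pr(g\mid O)\leftarrow\eta\cdot\textit{score}(g)$. (e) $\upsilon\leftarrow\arg\max_{g\in G}Pr(g\mid O)$. **Baseline online recognition algorithm** (of Vered and Kaminka). For every goal $g\in G$ the ideal plan $i_g$ is generated once by one call to the planner from $I$ to $g$. Then, for every new observation $o$ and every goal $g\in G$, the plan $m_g=m_g^-\oplus m_g^+$ is re-synthesized: $m_g^-$ is the concatenation of all observations so far, and $m_g^+$ is generated by one call to the planner from the last observed point to $g$. Goals are then ranked by $\textit{score}(g)$. It thus makes $(1+|O|)\,|G|$ planner calls in total. *)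

(* Defs.v *)
(* MathComp-Analysis, over an arbitrary [R : realType]. *)
From HB Require Import structures.
From mathcomp Require Import all_boot all_order all_algebra.
From mathcomp Require Import finmap.
From mathcomp Require Import all_classical all_reals all_analysis.
Import Order.TTheory GRing.Theory Num.Theory.
Import numFieldNormedType.Exports.

Set Implicit Arguments.
Unset Strict Implicit.
Unset Printing Implicit Defensive.

Local Open Scope classical_set_scope.
Local Open Scope ring_scope.

(* The norm that MathComp-Analysis puts on ['rV[R]_n] is the max norm, which
   induces the same topology but not the same closest points. *)
Definition euclid_dist (R : realType) (n : nat) (p q : 'rV[R]_n) : R :=
  Num.sqrt (\sum_(i < n) (p ord0 i - q ord0 i) ^+ 2).

(* A nonempty trajectory is a continuous curve parametrized by [0, 1]; the
   values of [curve] outside [0, 1] are irrelevant. *)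
Record trajectory (R : realType) (n : nat) := Trajectory {
  curve :> R -> 'rV[R]_n;
  curve_continuous : {within `[0, 1], continuous curve} }.

Definition start (R : realType) (n : nat) (m : trajectory R n) : 'rV[R]_n :=
  m 0.

Definition finish (R : realType) (n : nat) (m : trajectory R n) : 'rV[R]_n :=
  m 1.

Lemma point_trajectory_subproof (R : realType) (n : nat) (p : 'rV[R]_n) :
  {within `[0, 1], continuous (fun _ : R => p)}.
Proof. by apply: continuous_subspaceT => x; exact: cvg_cst. Qed.

Definition point_trajectory (R : realType) (n : nat) (p : 'rV[R]_n) :
  trajectory R n := Trajectory (@point_trajectory_subproof R n p).

(* Concatenations of trajectories. The empty list is the empty trajectory and
   [++] is concatenation. The pieces are kept apart because consecutive
   observations need not be adjacent, so that the concatenation of two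
   trajectories need not be a continuous curve. *)
Definition concat_trajectory (R : realType) (n : nat) : Type :=
  seq (trajectory R n).

Inductive observation (R : realType) (n : nat) : Type :=
| ObsPoint of 'rV[R]_n
| ObsTrajectory of trajectory R n.
Arguments ObsPoint {R n} _.
Arguments ObsTrajectory {R n} _.

HB.instance Definition _ (R : realType) (n : nat) :=
  gen_eqMixin (observation R n).
HB.instance Definition _ (R : realType) (n : nat) :=
  gen_choiceMixin (observation R n).

Definition trajectory_of_obs (R : realType) (n : nat) (o : observation R n) :
  trajectory R n :=
  match o with
  | ObsPoint p => point_trajectory p
  | ObsTrajectory m => m
  end.

Definition obs_set (R : realType) (n : nat) (o : observation R n) :
  set 'rV[R]_n := trajectory_of_obs o @` `[0, 1].

Definition last_point (R : realType) (n : nat) (o : observation R n) :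
  'rV[R]_n := finish (trajectory_of_obs o).

Record problem (R : realType) (n : nat) := Problem {
  world : set 'rV[R]_n;
  init : 'rV[R]_n;
  goals : {fset 'rV[R]_n};
  observations : {fset observation R n};
  plans : set (trajectory R n);
  init_world : world init;
  goals_world : forall g, g \in goals -> world g;
  observations_world : forall o, o \in observations -> obs_set o `<=` world;
  plans_ends : forall m, plans m -> start m = init /\ finish m \in goals;
  plans_goals : forall g, g \in goals -> exists2 m, plans m & finish m = g }.

(* The source of a planner call is an observation, or a single point such as
   the initial pose. *)
Record planner (R : realType) (n : nat) := Planner {
  plan :> observation R n -> 'rV[R]_n -> trajectory R n;
  plan_start : forall x g, start (plan x g) = last_point x;
  plan_finish : forall x g, finish (plan x g) = g }.

(* Programs that may query a planner. The planner is a black box: the only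
   access a program has to it is the node [Call x g k], which asks for a
   trajectory from [x] to [g] and continues as [k] with the answer. *)
Inductive prog (R : realType) (n : nat) (A : Type) : Type :=
| Ret of A
| Call of observation R n & 'rV[R]_n & (trajectory R n -> prog R n A).
Arguments Ret {R n A} _.
Arguments Call {R n A} _ _ _.

Fixpoint bind (R : realType) (n : nat) (A B : Type) (c : prog R n A)
    (f : A -> prog R n B) : prog R n B :=
  match c with
  | Ret a => f a
  | Call x g k => Call x g (fun m => bind (k m) f)
  end.

Notation "'let*' x := c 'in' d" := (bind c (fun x => d))
  (at level 200, x name, c at level 200, d at level 200).

Definition call (R : realType) (n : nat) (x : observation R n)
    (g : 'rV[R]_n) : prog R n (trajectory R n) := Call x g (fun m => Ret m).

Fixpoint for_each (R : realType) (n : nat) (A B : Type)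
    (body : A -> prog R n B) (s : seq A) : prog R n (seq B) :=
  match s with
  | [::] => Ret [::]
  | a :: s' => let* b := body a in
               let* bs := for_each body s' in Ret (b :: bs)
  end.

Fixpoint for_loop (R : realType) (n : nat) (A S : Type)
    (body : S -> A -> prog R n S) (st : S) (s : seq A) : prog R n S :=
  match s with
  | [::] => Ret st
  | a :: s' => let* st' := body st a in for_loop body st' s'
  end.

Fixpoint num_calls (R : realType) (n : nat) (A : Type) (pl : planner R n)
    (c : prog R n A) : nat :=
  match c with
  | Ret _ => 0%N
  | Call x g k => (num_calls pl (k (pl x g))).+1
  end.

Lemma restrict_subproof (R : realType) (n : nat) (m : trajectory R n)
    (a b : R) : 0 <= a <= 1 -> 0 <= b <= 1 ->
  {within `[0, 1], continuous (fun u : R => m (a + u * (b - a)))}.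
Proof.
move=> /andP[a0 a1] /andP[b0 b1].
have cf : continuous (fun u : R => a + u * (b - a)).
  move=> x; apply: cvgD; first exact: cvg_cst.
  by apply: cvgM; [exact: cvg_id | exact: cvg_cst].
have sub u : 0 <= u <= 1 -> 0 <= a + u * (b - a) <= 1.
  move=> /andP[u0 u1].
  have -> : a + u * (b - a) = (1 - u) * a + u * b.
    by rewrite mulrBr mulrBl mul1r addrCA addrC -addrA [- _ + _]addrC.
  rewrite addr_ge0 ?mulr_ge0 ?subr_ge0//=.
  rewrite (@le_trans _ _ ((1 - u) * 1 + u * 1))//; last by rewrite !mulr1 subrK.
  by rewrite lerD// ler_wpM2l// subr_ge0.
apply/subspace_continuousP => x; rewrite /= in_itv /= => x01.
have /subspace_continuousP mc := @curve_continuous _ _ m.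
have fx : `[0, 1]%classic (a + x * (b - a)) by rewrite /= in_itv /= sub.
apply: cvg_trans (mc _ fx) => /=.
move=> P /= [e e0 eP].
have [d /= d0 dP] := cf x _ (nbhsx_ballx _ _ e0).
exists d => // u xu /=; rewrite in_itv /= => u01.
apply: eP; first exact: dP.
by rewrite /= in_itv /= sub.
Qed.

(* The part of [m] between the parameters [a] and [b], reparametrized by
   [0, 1]. *)
Definition restrict (R : realType) (n : nat) (m : trajectory R n) (a b : R)
    (ha : 0 <= a <= 1) (hb : 0 <= b <= 1) : trajectory R n :=
  Trajectory (@restrict_subproof R n m a b ha hb).

Definition dist_to_obs (R : realType) (n : nat) (o : observation R n)
    (p : 'rV[R]_n) : R := inf [set euclid_dist p q | q in obs_set o].

(* Some parameter at which [m] is closest to [o]; one exists by compactness. *)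
Definition closest_param (R : realType) (n : nat) (o : observation R n)
    (m : trajectory R n) : R :=
  xget 0 [set t : R | 0 <= t <= 1 /\
    forall s : R, 0 <= s <= 1 -> dist_to_obs o (m t) <= dist_to_obs o (m s)].

Lemma zero_in_unit (R : realType) : (0 : R) <= (0 : R) <= (1 : R).
Proof. by rewrite lexx ler01. Qed.

Lemma one_in_unit (R : realType) : (0 : R) <= (1 : R) <= (1 : R).
Proof. by rewrite lexx ler01. Qed.

Lemma closest_param_unit (R : realType) (n : nat) (o : observation R n)
  (m : trajectory R n) : 0 <= closest_param o m <= 1.
Proof.
by rewrite /closest_param; case: xgetP => [t _ [] //|_]; exact: zero_in_unit.
Qed.

Definition obs_prefix (R : realType) (n : nat) (o : observation R n)
    (m : trajectory R n) : trajectory R n :=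
  restrict m (zero_in_unit R) (closest_param_unit o m).

(* [m] with [obs_prefix o m] removed. *)
Definition minus_obs_prefix (R : realType) (n : nat) (o : observation R n)
    (m : trajectory R n) : trajectory R n :=
  restrict m (closest_param_unit o m) (one_in_unit R).

(* The variables attached to a goal [g]: the ideal plan i_g, m_g^-, m_g^+ and
   m_g. *)
Record goal_state (R : realType) (n : nat) := GoalState {
  goal : 'rV[R]_n;
  ideal : trajectory R n;
  m_minus : concat_trajectory R n;
  m_plus : trajectory R n;
  m_full : concat_trajectory R n }.

(* "For all g in G: i_g <- planner(I, g); m_g^+ <- i_g", with m_g and m_g^-
   empty. *)
Definition initialize (R : realType) (n : nat) (P : problem R n) :
    prog R n (seq (goal_state R n)) :=
  for_each (fun g => let* i := call (ObsPoint (init P)) g in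
                     Ret (GoalState g i [::] i [::]))
           (enum_fset (goals P)).

Definition set_m_plus (R : realType) (n : nat) (m : trajectory R n)
    (s : goal_state R n) : goal_state R n :=
  GoalState (goal s) (ideal s) (m_minus s) m (m_full s).

(* m_g^- <- m_g^- (+) o, then m_g <- m_g^- (+) m_g^+. *)
Definition observe (R : realType) (n : nat) (o : observation R n)
    (s : goal_state R n) : goal_state R n :=
  let past := m_minus s ++ [:: trajectory_of_obs o] in
  GoalState (goal s) (ideal s) past (m_plus s) (past ++ [:: m_plus s]).

Definition score (R : realType) (n : nat) (cost : concat_trajectory R n -> R)
    (s : goal_state R n) : R := cost [:: ideal s] / cost (m_full s).

Definition posterior (R : realType) (n : nat)
    (cost : concat_trajectory R n -> R) (live : seq (goal_state R n))
    (s : goal_state R n) : R :=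
  (\sum_(s' <- live) score cost s')^-1 * score cost s.

(* The first maximizer of [f] in the list, [None] on the empty list. *)
Fixpoint arg_max_seq (R : realType) (A : Type) (f : A -> R) (s : seq A) :
    option A :=
  match s with
  | [::] => None
  | a :: s' => match arg_max_seq f s' with
               | Some b => if f b <= f a then Some a else Some b
               | None => Some a
               end
  end.

(* [live] holds the goals that are currently in G; [top_goal] is the
   top-ranked one, [None] standing for the empty value. *)
Record ogr_state (R : realType) (n : nat) := OgrState {
  live : seq (goal_state R n);
  top_goal : option 'rV[R]_n }.

Definition top_plan (R : realType) (n : nat) (st : ogr_state R n) :
    concat_trajectory R n :=
  match [seq s <- live st | Some (goal s) == top_goal st] with
  | [::] => [::]
  | s :: _ => m_full s
  end.

Definition replan_or_prune (R : realType) (n : nat)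
    (PRUNE : trajectory R n -> observation R n -> 'rV[R]_n -> bool)
    (o : observation R n) (s : goal_state R n) :
    prog R n (option (goal_state R n)) :=
  if PRUNE (m_plus s) o (goal s) then Ret None
  else let* m := call o (goal s) in Ret (Some (set_m_plus m s)).

Definition ogr_step (R : realType) (n : nat)
    (cost : concat_trajectory R n -> R)
    (RECOMPUTE : concat_trajectory R n -> observation R n -> bool)
    (PRUNE : trajectory R n -> observation R n -> 'rV[R]_n -> bool)
    (st : ogr_state R n) (o : observation R n) : prog R n (ogr_state R n) :=
  let* G1 :=
    if RECOMPUTE (top_plan st) o then
      let* ss := for_each (replan_or_prune PRUNE o) (live st) in
      Ret (pmap id ss)
    else
      Ret [seq set_m_plus (minus_obs_prefix o (m_plus s)) s | s <- live st] in
  let G2 := [seq observe o s | s <- G1] in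
  Ret (OgrState G2 (omap (@goal R n) (arg_max_seq (posterior cost G2) G2))).

Definition online_goal_recognition (R : realType) (n : nat)
    (cost : concat_trajectory R n -> R)
    (RECOMPUTE : concat_trajectory R n -> observation R n -> bool)
    (PRUNE : trajectory R n -> observation R n -> 'rV[R]_n -> bool)
    (P : problem R n) (os : seq (observation R n)) :
    prog R n (ogr_state R n) :=
  let* G0 := initialize P in
  for_loop (ogr_step cost RECOMPUTE PRUNE) (OgrState G0 None) os.

Definition baseline_step (R : realType) (n : nat)
    (G0 : seq (goal_state R n)) (o : observation R n) :
    prog R n (seq (goal_state R n)) :=
  for_each (fun s => let* m := call (ObsPoint (last_point o)) (goal s) in
                     Ret (observe o (set_m_plus m s))) G0.

Definition rank_by_score (R : realType) (n : nat)
    (cost : concat_trajectory R n -> R) (G0 : seq (goal_state R n)) :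
    seq (goal_state R n) :=
  sort (fun s s' => score cost s' <= score cost s) G0.

(* Returns the goals by decreasing score. *)
Definition baseline (R : realType) (n : nat)
    (cost : concat_trajectory R n -> R)
    (P : problem R n) (os : seq (observation R n)) :
    prog R n (seq (goal_state R n)) :=
  let* G0 := initialize P in
  for_loop (fun G1 o => let* G2 := baseline_step G1 o in
                        Ret (rank_by_score cost G2)) G0 os.

(* Main.v *)
(* On any list of goal states, an iteration of either loop makes one call per
   goal and keeps the number of goals: with nothing pruned, the length of the
   list is invariant. Both algorithms start from the same initialization, so
   both continue with [size os * size G0] calls. *)
Require Import Defs.
From mathcomp Require Import all_boot all_order all_algebra finmap.
From mathcomp Require Import all_classical all_reals all_analysis.

(** Companion of [num_calls]: in a [bind], the calls made by the continuation depend on the value it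
    receives, so counting calls needs that value as well. *)
Fixpoint run {R : realType} {n : nat} {A : Type} (pl : planner R n)
    (c : prog R n A) : A :=
  match c with
  | Ret a => a
  | Call x g k => run pl (k (pl x g))
  end.

Lemma run_bind {R : realType} {n : nat} {A B : Type} (pl : planner R n)
    (c : prog R n A) (f : A -> prog R n B) :
  run pl (bind c f) = run pl (f (run pl c)).
Proof. by elim: c => //= x g k IHk; rewrite IHk. Qed.

Lemma num_calls_bind {R : realType} {n : nat} {A B : Type} (pl : planner R n)
    (c : prog R n A) (f : A -> prog R n B) :
  num_calls pl (bind c f) = num_calls pl c + num_calls pl (f (run pl c)).
Proof. by elim: c => //= x g k IHk; rewrite IHk. Qed.

Lemma run_for_each {R : realType} {n : nat} {A B : Type} (pl : planner R n)
    (body : A -> prog R n B) (s : seq A) :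
  run pl (for_each body s) = [seq run pl (body a) | a <- s].
Proof. by elim: s => //= a s IHs; rewrite !run_bind IHs. Qed.

Lemma num_calls_for_each {R : realType} {n : nat} {A B : Type}
    (pl : planner R n) (body : A -> prog R n B) (s : seq A)
    (body1 : forall a, num_calls pl (body a) = 1) :
  num_calls pl (for_each body s) = size s.
Proof. by elim: s => //= a s IHs; rewrite !num_calls_bind body1 IHs addn0. Qed.

(** [mu] is at once the cost of an iteration and a loop invariant, so each iteration costs as much
    as the first, whatever else changes in the state. *)
Lemma num_calls_for_loop {R : realType} {n : nat} {A S : Type}
    (pl : planner R n) (body : S -> A -> prog R n S) (mu : S -> nat)
    (body_calls : forall st a, num_calls pl (body st a) = mu st)
    (body_mu : forall st a, mu (run pl (body st a)) = mu st)
    (st : S) (s : seq A) :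
  num_calls pl (for_loop body st s) = size s * mu st.
Proof.
elim: s st => //= a s IHs st.
by rewrite num_calls_bind IHs body_calls body_mu mulSn.
Qed.

Lemma run_replan_or_prune {R : realType} {n : nat} (pl : planner R n)
    (PRUNE : trajectory R n -> observation R n -> 'rV[R]_n -> bool)
    (PRUNE_bot : forall m o g, PRUNE m o g = false)
    (o : observation R n) (s : goal_state R n) :
  run pl (replan_or_prune PRUNE o s) = Some (set_m_plus (pl o (goal s)) s).
Proof. by rewrite /replan_or_prune PRUNE_bot. Qed.

Lemma num_calls_ogr_step {R : realType} {n : nat} (pl : planner R n)
    (cost : concat_trajectory R n -> R)
    (RECOMPUTE : concat_trajectory R n -> observation R n -> bool)
    (PRUNE : trajectory R n -> observation R n -> 'rV[R]_n -> bool)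
    (RECOMPUTE_top : forall m o, RECOMPUTE m o = true)
    (PRUNE_bot : forall m o g, PRUNE m o g = false)
    (st : ogr_state R n) (o : observation R n) :
  num_calls pl (ogr_step cost RECOMPUTE PRUNE st o) = size (live st).
Proof.
(* Only the replanning loop queries the planner; the updates and the ranking are [Ret] nodes, whose
   zero counts vanish here. *)
rewrite /ogr_step RECOMPUTE_top !num_calls_bind /= !addn0.
by apply: num_calls_for_each => s; rewrite /replan_or_prune PRUNE_bot.
Qed.

Lemma size_live_ogr_step {R : realType} {n : nat} (pl : planner R n)
    (cost : concat_trajectory R n -> R)
    (RECOMPUTE : concat_trajectory R n -> observation R n -> bool)
    (PRUNE : trajectory R n -> observation R n -> 'rV[R]_n -> bool)
    (RECOMPUTE_top : forall m o, RECOMPUTE m o = true)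
    (PRUNE_bot : forall m o g, PRUNE m o g = false)
    (st : ogr_state R n) (o : observation R n) :
  size (live (run pl (ogr_step cost RECOMPUTE PRUNE st o))) = size (live st).
Proof.
rewrite /ogr_step RECOMPUTE_top !run_bind /= size_map run_for_each.
(* Every entry is now a [Some], so the predicate counted by [size_pmap] is constantly true and
   [pmap id] discards nothing. *)
rewrite (eq_map (run_replan_or_prune pl PRUNE PRUNE_bot o)) size_pmap.
by rewrite count_map count_predT.
Qed.

Lemma num_calls_baseline_step {R : realType} {n : nat} (pl : planner R n)
    (G0 : seq (goal_state R n)) (o : observation R n) :
  num_calls pl (baseline_step G0 o) = size G0.
(* The count of the loop body reduces to 1 by computation. *)
Proof. exact: num_calls_for_each. Qed.

Lemma size_baseline_step {R : realType} {n : nat} (pl : planner R n)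
    (G0 : seq (goal_state R n)) (o : observation R n) :
  size (run pl (baseline_step G0 o)) = size G0.
Proof. by rewrite /baseline_step run_for_each size_map. Qed.

Theorem theorem1 (R : realType) (n : nat) (P : problem R n)
    (pl : planner R n) (cost : concat_trajectory R n -> R)
    (RECOMPUTE : concat_trajectory R n -> observation R n -> bool)
    (PRUNE : trajectory R n -> observation R n -> 'rV[R]_n -> bool)
    (os : seq (observation R n))
    (os_enum : perm_eq os (enum_fset (observations P)))
    (RECOMPUTE_top : forall m o, RECOMPUTE m o = true)
    (PRUNE_bot : forall m o g, PRUNE m o g = false) :
  num_calls pl (online_goal_recognition cost RECOMPUTE PRUNE P os) =
  num_calls pl (baseline cost P os).
Proof.
rewrite !num_calls_bind; congr (_ + _).
rewrite (num_calls_for_loop pl _ (fun st => size (live st))).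
(* The initial [live] list reduces to the result of [initialize P], from which the baseline loop
   also starts, so the two products agree by computation. *)
- rewrite (num_calls_for_loop pl _ size) // => G1 o.
  + by rewrite num_calls_bind num_calls_baseline_step addn0.
  (* Ranking only sorts the goal states, whatever their scores, so it keeps their number. *)
  + by rewrite run_bind size_sort size_baseline_step.
- exact: num_calls_ogr_step.
- exact: size_live_ogr_step.
Qed.
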